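(* Let $n\ge1$ and $\boldsymbol p=(p_n,p_n',q_n,\dots,p_1,p_1',q_1)\in\mathcal I_n$. Then the Perron-Frobenius eigenvalue $\lambda_{\boldsymbol p}$ of $M_{\boldsymbol p}$ and an eigenvector $\boldsymbol v>\boldsymbol 0$ for it are given by $$\lambda_{\boldsymbol p}=\frac1{w_{\boldsymbol p,n}}\qquad\text{and}\qquad \boldsymbol v=\begin{pmatrix}s_{\boldsymbol p}\\ h_{\boldsymbol p,0}\\ 1-s_{\boldsymbol p}\end{pmatrix}.$$
   Context: $\mathbb N_0=\mathbb N\cup\{0\}$. $\mathcal I_n$ is the set of $\boldsymbol p=(p_n,p_n',q_n,\dots,p_1,p_1',q_1)\in\mathbb N_0^{3n}$ such that $p_i+p_i'>0$ and $q_i>0$ for every $i$, and there exist $j,k\in\{1,\dots,n\}$ with $p_j>0$ and $p_k'>0$. $M_1=\begin{pmatrix}1&1&0\\0&1&0\\0&0&1\end{pmatrix}$, $M_3=\begin{pmatrix}1&0&0\\0&1&0\\0&1&1\end{pmatrix}$, $M_2=\begin{pmatrix}1&0&0\\1&1&1\\0&0&1\end{pmatrix}$, and $M_{\boldsymbol p}=M_1^{p_n}M_3^{p_n'}M_2^{q_n}\cdots M_1^{p_1}M_3^{p_1'}M_2^{q_1}$. A nonnegative integer square matrix is Perron-Frobenius if some power is positive; it then has a real eigenvalue $>1$ exceeding the moduli of all other eigenvalues (its Perron-Frobenius eigenvalue), with a strictly positive eigenvector unique up to scaling. $M_{\boldsymbol p}$ is Perron-Frobenius. $[a_0,a_1,a_2,\dots]=a_0+\cfrac1{a_1+\cfrac1{a_2+\cdots}}$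 denotes an infinite continued fraction and an overline denotes an infinitely repeated period. With all indices of $p,p',q$ read modulo $n$ (so $p_0=p_n$, etc.), define, for $j\in\mathbb N_0$, $$w_{\boldsymbol p,0}=1,\qquad h_{\boldsymbol p,0}=[0,\overline{p_n+p_n',q_n,\dots,p_1+p_1',q_1}],$$ and for $j>0$ $$w_{\boldsymbol p,j}=w_{\boldsymbol p,j-1}-(p_{n-j+1}+p_{n-j+1}')\,h_{\boldsymbol p,j-1},\qquad h_{\boldsymbol p,j}=h_{\boldsymbol p,j-1}-q_{n-j+1}\,w_{\boldsymbol p,j}.$$ The split ratio is $s_{\boldsymbol p}=\sum_{i=0}^\infty p_{-i}\,h_{\boldsymbol p,i}$. *)

(* Defs.v *)
From HB Require Import structures.
From mathcomp Require Import all_boot all_order all_algebra.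
From mathcomp Require Import all_classical all_reals all_analysis.
From mathcomp.real_closed Require Import complex.

Set Implicit Arguments.
Unset Strict Implicit.
Unset Printing Implicit Defensive.

Import Order.TTheory GRing.Theory Num.Theory.
Import numFieldNormedType.Exports.

Local Open Scope classical_set_scope.
Local Open Scope ring_scope.
Local Open Scope complex_scope.

(* The ordinal k : 'I_n stands for the residue class of k modulo n, so the
   index n of the usual numbering 1, ..., n is the ordinal 0. *)
Record params (n : nat) := Params {
  par_p : 'I_n -> nat;
  par_p' : 'I_n -> nat;
  par_q : 'I_n -> nat
}.

Definition admissible (n : nat) (P : params n) : Prop :=
  [/\ forall i, (0 < par_p P i + par_p' P i)%N,
      forall i, (0 < par_q P i)%N,
      exists j, (0 < par_p P j)%N &
      exists k, (0 < par_p' P k)%N].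

(* [cyc x i] is x_i with the integer index i read modulo n; for 0 < n the
   residue is always < n, so the default value 0 is never used. *)
Definition cyc (n : nat) (x : 'I_n -> nat) (i : int) : nat :=
  if insub `|(i %% n%:Z)%Z|%N is Some k then x k else 0%N.

Definition mx3 (s : seq (seq nat)) : 'M[nat]_3 :=
  \matrix_(i < 3, j < 3) nth 0%N (nth [::] s i) j.

Definition M1 : 'M[nat]_3 := mx3 [:: [:: 1; 1; 0]; [:: 0; 1; 0]; [:: 0; 0; 1]]%N.
Definition M2 : 'M[nat]_3 := mx3 [:: [:: 1; 0; 0]; [:: 1; 1; 1]; [:: 0; 0; 1]]%N.
Definition M3 : 'M[nat]_3 := mx3 [:: [:: 1; 0; 0]; [:: 0; 1; 0]; [:: 0; 1; 1]]%N.

Definition Mfactor (n : nat) (P : params n) (i : int) : 'M[nat]_3 :=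
  M1 ^+ cyc (par_p P) i * M3 ^+ cyc (par_p' P) i * M2 ^+ cyc (par_q P) i.

(* The product is noncommutative: the leftmost factor has index n, the
   rightmost has index 1. *)
Definition Mmat (n : nat) (P : params n) : 'M[nat]_3 :=
  \prod_(0 <= k < n) Mfactor P (n%:Z - k%:Z).

Definition nat_mx (S : pzSemiRingType) (m1 m2 : nat) (A : 'M[nat]_(m1, m2)) :
    'M[S]_(m1, m2) :=
  map_mx (fun k : nat => k%:R : S) A.

Definition perron_frobenius (m : nat) (A : 'M[nat]_m.+1) : Prop :=
  exists2 k : nat, (0 < k)%N & forall i j, (0 < (A ^+ k) i j)%N.

(* [eigenvalue] refers to row vectors; a square matrix and its transpose have
   the same spectrum, so this is also the spectrum for column vectors. *)
Definition perron_frobenius_eigenvalue (R : realType) (m : nat)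
    (A : 'M[nat]_m.+1) (l : R) : Prop :=
  [/\ perron_frobenius A,
      1 < l,
      eigenvalue (nat_mx R A) l &
      forall z : R[i], eigenvalue (nat_mx R[i] A) z -> z != l%:C ->
        `|z| < l%:C].

(* [cf_convergent R a k] is the finite continued fraction [a_0, ..., a_k]. *)
Fixpoint cf_convergent (R : realType) (a : nat -> nat) (k : nat) : R :=
  if k is k'.+1 then (a 0%N)%:R + (cf_convergent R (fun i => a i.+1) k')^-1
  else (a 0%N)%:R.

Definition contfrac (R : realType) (a : nat -> nat) : R :=
  limn (cf_convergent R a).

Definition preperiodic (a0 : nat) (s : seq nat) (k : nat) : nat :=
  if k is k'.+1 then nth 0%N s (k' %% size s)%N else a0.

Definition cf_period (n : nat) (P : params n) : seq nat :=
  flatten [seq let i := n%:Z - k%:Z in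
               [:: (cyc (par_p P) i + cyc (par_p' P) i)%N; cyc (par_q P) i]
          | k <- iota 0 n].

Definition cf_coeff (n : nat) (P : params n) : nat -> nat :=
  preperiodic 0 (cf_period P).

Fixpoint wh (R : realType) (n : nat) (P : params n) (j : nat) : R * R :=
  if j is j'.+1 then
    let i := n%:Z - j%:Z + 1 in
    let w := (wh R P j').1
             - (cyc (par_p P) i + cyc (par_p' P) i)%:R * (wh R P j').2 in
    (w, (wh R P j').2 - (cyc (par_q P) i)%:R * w)
  else (1, contfrac R (cf_coeff P)).

Definition w_ (R : realType) (n : nat) (P : params n) (j : nat) : R :=
  (wh R P j).1.

Definition h_ (R : realType) (n : nat) (P : params n) (j : nat) : R :=
  (wh R P j).2.

Definition split_term (R : realType) (n : nat) (P : params n) (i : nat) : R :=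
  (cyc (par_p P) (- i%:Z))%:R * h_ R P i.

Definition split_ratio (R : realType) (n : nat) (P : params n) : R :=
  limn (series (split_term R P)).

Definition pf_vector (R : realType) (n : nat) (P : params n) : 'cV[R]_3 :=
  \col_(i < 3) nth 0 [:: split_ratio R P; h_ R P 0; 1 - split_ratio R P] i.

(* Main.v *)
Require Import Defs.
From mathcomp Require Import all_boot all_order all_algebra.
From mathcomp Require Import all_classical all_reals all_analysis.
From mathcomp Require Import ring lra zify.
From mathcomp.real_closed Require Import complex.

Import numFieldNormedType.Exports.

Local Open Scope classical_set_scope.
Local Open Scope ring_scope.

Set Implicit Arguments.
Unset Strict Implicit.
Unset Printing Implicit Defensive.

Import Order.TTheory GRing.Theory Num.Theory.

(** Write a_k, b_k, c_k for p_{n-k}, p'_{n-k}, q_{n-k}, and consider the vectors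
      v_k = (s - S_k, h_k, w_k - (s - S_k)),  S_k = a_0 h_0 + ... + a_{k-1} h_{k-1},
    which attach to the k-th stage of the subtractive algorithm (w, h) the tail
    s - S_k of the split series.  The recursion for (w, h) says exactly that the
    k-th factor of M_p maps v_{k+1} to v_k ([Mfactor_tail_vector]): the factor
    M_2^{c_k} undoes the passage from h_k to h_{k+1}, and M_1^{a_k} M_3^{b_k}
    distributes the removed length (a_k + b_k) h_k over the two outer entries.
    Hence M_p v_n = v_0, and v_0 is the vector of the theorem.

    The algorithm is the Euclidean algorithm on (w_0, h_0) = (1, h_0), so that
    h_k / w_k is the reciprocal of the 2k-th complete quotient of the continued
    fraction ([wh_ratio]).  Complete quotients exceed 1, whence w_k and h_k are
    positive; and they are periodic with period 2n, whence h_n / w_n = h_0 / w_0.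
    By linearity everything is then multiplied by w_n after n steps: the pairs
    (w_k, h_k) by [wh_period] and the tails of the split series by
    [split_ratio_period].  So v_n = w_n v_0, that is M_p v_0 = v_0 / w_n.

    The split series and its counterpart with b_k in place of a_k have
    nonnegative terms and partial sums adding up to 1 - w_N
    ([split_series_complement]).  So the split series converges, and 0 < s < 1
    because some a_k and some b_k are positive.

    Finally, every factor has a positive diagonal, so positive entries survive in
    the product; all entries of M_p in the middle row and the middle column are
    positive, so M_p^2 > 0.  A positive eigenvector of a Perron-Frobenius matrix
    belongs to an eigenvalue that strictly dominates all the others
    ([positive_eigenvector_dominates]). *)

(** * Convergence of continued fractions *)

Lemma cf_convergent_ge1 (R : realType) (a : nat -> nat) (k : nat) :
  (forall i, (0 < a i)%N) -> 1 <= cf_convergent R a k.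
Proof.
elim: k a => [|k IHk] a a_gt0 /=; first by rewrite ler1n.
have := IHk (fun i => a i.+1) (fun i => a_gt0 i.+1) => x_ge1.
by rewrite ler_wpDr ?ler1n// invr_ge0 (le_trans ler01).
Qed.

(** On [1, +oo[ a map x |-> z + 1/x, z >= 1, does not increase distances, and two
    successive such maps contract them by a factor 4, because
    x (z + 1/x) = z x + 1 >= 2.  So the bound for k + 2 follows from the bound
    for k after two shifts, which forces the induction to range over all
    coefficient sequences.  The leading coefficient may vanish, as it cancels in
    the difference. *)
Lemma cf_convergent_dist (R : realType) (a : nat -> nat) (k m : nat) :
  (forall i, (0 < a i.+1)%N) ->
  `|cf_convergent R a (k + m) - cf_convergent R a k| <= 2 * 2^-1 ^+ k.
Proof.
have tail_ge1 (b : nat -> nat) j : (forall i, (0 < b i.+1)%N) ->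
    1 <= cf_convergent R (fun i => b i.+1) j.
  by move=> b_gt0; exact: cf_convergent_ge1.
have base (b : nat -> nat) : (forall i, (0 < b i.+1)%N) ->
    `|cf_convergent R b m - cf_convergent R b 0| <= 1.
  move=> b_gt0; case: m => [|j] /=; first by rewrite subrr normr0.
  have x_ge1 := tail_ge1 b j b_gt0.
  rewrite addrAC subrr add0r ger0_norm ?invr_ge0 ?(le_trans ler01)//.
  by rewrite invf_le1// (lt_le_trans ltr01).
have step (x y : R) : 1 <= x -> 1 <= y -> `|x^-1 - y^-1| = `|x - y| / (x * y).
  move=> x1 y1; have xy : 0 < x * y by nra.
  rewrite -[X in _ / X](gtr0_norm xy) -normf_div distrC; congr `|_|.
  by field; apply/andP; split; lra.
suff [] : (forall b : nat -> nat, (forall i, (0 < b i.+1)%N) ->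
      `|cf_convergent R b (k + m) - cf_convergent R b k| <= 2 * 2^-1 ^+ k) /\
    (forall b : nat -> nat, (forall i, (0 < b i.+1)%N) ->
      `|cf_convergent R b (k.+1 + m) - cf_convergent R b k.+1|
        <= 2 * 2^-1 ^+ k.+1) by move=> H _ a_gt0; exact: H.
elim: k => [|k [IH0 IH1]].
  split=> b b_gt0; first by have := base b b_gt0; rewrite add0n expr0; lra.
  have bS_gt0 i : (0 < b i.+2)%N by exact: b_gt0.
  have := base (fun i => b i.+1) bS_gt0; rewrite add1n /=.
  set y := cf_convergent R (fun i => b i.+1) m => d.
  have y1 : 1 <= y by exact: tail_ge1.
  have z1 : 1 <= (b 1)%:R :> R by rewrite ler1n b_gt0.
  rewrite opprD addrACA subrr add0r expr1 mulfV// step//.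
  rewrite ler_pdivrMr ?mul1r; last by nra.
  by apply: (le_trans d); nra.
split=> // b b_gt0; rewrite !addSn /=.
have := IH0 (fun i => b i.+2) (fun i => b_gt0 i.+2).
have := tail_ge1 (fun i => b i.+1) k (fun i => b_gt0 i.+1) => /=.
have := tail_ge1 (fun i => b i.+1) (k + m)%N (fun i => b_gt0 i.+1) => /=.
set x := cf_convergent R (fun i => b i.+2) (k + m).
set y := cf_convergent R (fun i => b i.+2) k => x1 y1 d.
have z1 : 1 <= (b 1)%:R :> R by rewrite ler1n b_gt0.
set z : R := (b 1)%:R in z1 *.
rewrite [(b 0)%:R + _]addrC addrKA step; last first.
- by rewrite (le_trans z1)// lerDl invr_ge0; lra.
- by rewrite (le_trans z1)// lerDl invr_ge0; lra.
rewrite [z + x^-1]addrC addrKA step//.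
have -> : `|x - y| / (x * y) / ((x^-1 + z) * (z + y^-1)) =
    `|x - y| / ((z * x + 1) * (z * y + 1)).
  by field; apply/and4P; split; apply: lt0r_neq0; nra.
have zx : 2 <= z * x + 1 by nra.
have zy : 2 <= z * y + 1 by nra.
have zxy : 4 <= (z * x + 1) * (z * y + 1) by nra.
rewrite ler_pdivrMr; last by lra.
apply: (le_trans d); rewrite !exprS.
have : 0 <= 2^-1 ^+ k :> R by rewrite exprn_ge0// invr_ge0.
set t := 2^-1 ^+ k => t0.
by nra.
Qed.

Lemma cf_convergent_cvg (R : realType) (a : nat -> nat) :
  (forall i, (0 < a i.+1)%N) -> cvgn (cf_convergent R a).
Proof.
move=> a_gt0; apply/cauchy_cvgP; apply: cauchy_exP => e e0.
have /cvgrPdist_lt /(_ _ (divr_gt0 e0 (ltr0n R 2))) [N _ HN] :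
  (GRing.exp (2^-1 : R) : R^nat) @ \oo --> (0 : R).
  by apply: cvg_expr; rewrite ger0_norm ?invr_ge0// invf_lt1 ?ltr1n.
exists (cf_convergent R a N); exists N => // j /= Nj.
rewrite /ball /= distrC -(subnKC Nj).
apply: (le_lt_trans (cf_convergent_dist R N _ a_gt0)).
have := HN N (leqnn N); rewrite /= sub0r normrN ger0_norm.
  by rewrite ltr_pdivlMr// mulrC.
by rewrite exprn_ge0// invr_ge0.
Qed.

Lemma contfrac_ge1 (R : realType) (a : nat -> nat) :
  (forall i, (0 < a i)%N) -> 1 <= contfrac R a.
Proof.
move=> a_gt0; apply: limr_ge; first exact: cf_convergent_cvg.
by apply: nearW => k; exact: cf_convergent_ge1.
Qed.

(** Passing to the limit in the recursion; the bound of 1 on the tail keeps the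
    inverse continuous there. *)
Lemma contfracE (R : realType) (a : nat -> nat) :
  (forall i, (0 < a i.+1)%N) ->
  contfrac R a = (a 0%N)%:R + (contfrac R (fun i => a i.+1))^-1.
Proof.
move=> a_gt0; apply/cvg_lim => //; rewrite -cvg_shiftS /=.
apply: cvgD; first exact: cvg_cst.
apply: cvgV; last exact: cf_convergent_cvg.
by apply: lt0r_neq0; rewrite (lt_le_trans ltr01)// contfrac_ge1.
Qed.

Lemma contfrac_gt1 (R : realType) (a : nat -> nat) :
  (forall i, (0 < a i)%N) -> 1 < contfrac R a.
Proof.
move=> a_gt0; rewrite contfracE//.
have : 0 < (contfrac R (fun i => a i.+1))^-1.
  by rewrite invr_gt0 (lt_le_trans ltr01)// contfrac_ge1.
have : 1 <= (a 0)%:R :> R by rewrite ler1n.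
lra.
Qed.

(** * Positive eigenvectors of Perron-Frobenius matrices *)

Lemma nat_mxX (S : nzSemiRingType) (m k : nat) (A : 'M[nat]_m.+1) :
  nat_mx S (A ^+ k) = nat_mx S A ^+ k.
Proof.
elim: k => [|k IHk]; first by rewrite !expr0 /nat_mx map_mx1.
rewrite !exprS -IHk; exact: (map_mxM (GRing.natmul (1 : S))).
Qed.

Lemma mulmxX_eigen (F : comNzRingType) (m k : nat) (A : 'M[F]_m.+1)
    (v : 'cV[F]_m.+1) (l : F) :
  A *m v = l *: v -> A ^+ k *m v = l ^+ k *: v.
Proof.
move=> Av; elim: k => [|k IHk]; first by rewrite !expr0 mul1mx scale1r.
by rewrite exprSr -mulmxA Av -scalemxAr IHk scalerA exprS.
Qed.

Lemma mulXmx_eigen (F : comNzRingType) (m k : nat) (A : 'M[F]_m.+1)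
    (u : 'rV[F]_m.+1) (l : F) :
  u *m A = l *: u -> u *m A ^+ k = l ^+ k *: u.
Proof.
move=> uA; elim: k => [|k IHk]; first by rewrite !expr0 mulmx1 scale1r.
by rewrite exprS mulmxA uA -scalemxAl IHk scalerA exprS.
Qed.

(** Bridges the two conventions: eigenvalues are defined by row vectors, the
    eigenvector of interest is a column. *)
Lemma right_eigenvalue (F : fieldType) (m : nat) (A : 'M[F]_m)
    (v : 'cV[F]_m) (l : F) :
  v != 0 -> A *m v = l *: v -> eigenvalue A l.
Proof.
move=> v0 Av; apply: contraNneq v0 => /eqP.
rewrite kermx_eq0 row_free_unit => Al_unit.
by rewrite -(mulKmx Al_unit v) mulmxBl Av mul_scalar_mx subrr mulmx0.
Qed.

(** A left eigenvector u for z <> l is orthogonal to the right eigenvector v.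
    So u does not see the rank-one matrix v e 1^T, which can be subtracted from
    N = A^k; with e = 1 / sum v the difference B is still nonnegative, since the
    entries of N are integers >= 1 and v_i e <= 1.  But B multiplies v by
    l^k - 1 only, so the l^1 norm of u weighted by v yields |z|^k <= l^k - 1. *)
Lemma positive_eigenvector_dominates (F : numFieldType) (m : nat)
    (A : 'M[nat]_m.+1) (v : 'cV[F]_m.+1) (l z : F) :
  perron_frobenius A -> 0 <= l -> (forall i, 0 < v i 0) ->
  nat_mx F A *m v = l *: v ->
  eigenvalue (nat_mx F A) z -> z != l -> `|z| < l.
Proof.
move=> [k k0 Apos] l0 v0 Av /eigenvalueP[u uA u0] zl.
have uv0 : u *m v = 0.
  have : (z - l) *: (u *m v) = 0.
    by rewrite scalerBl [X in X - _]scalemxAl -uA -mulmxA Av scalemxAr subrr.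
  by move/eqP; rewrite scaler_eq0 subr_eq0 (negPf zl) => /eqP.
pose N := nat_mx F (A ^+ k).
have uN : u *m N = z ^+ k *: u by rewrite /N nat_mxX; exact: mulXmx_eigen.
have Nv : N *m v = l ^+ k *: v by rewrite /N nat_mxX; exact: mulmxX_eigen.
pose S := \sum_i v i 0.
have vS i : v i 0 <= S.
  by rewrite /S (bigD1 i)//= lerDl sumr_ge0// => j _; exact: ltW.
have S0 : 0 < S by exact: lt_le_trans (v0 ord0) (vS _).
pose e := S^-1.
have e0 : 0 < e by rewrite invr_gt0.
have B0 i j : 0 <= N i j - e * v i 0.
  rewrite subr_ge0 (@le_trans _ _ 1)//; last by rewrite mxE ler1n Apos.
  by rewrite mulrC ler_pdivrMr ?mul1r.
have uB j : z ^+ k * u 0 j = \sum_i u 0 i * (N i j - e * v i 0).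
  have := congr1 (fun M : 'rV[F]_m.+1 => M 0 j) uN; rewrite !mxE => <-.
  have /(congr1 (fun M : 'M[F]_1 => M 0 0)) := uv0; rewrite !mxE => uv.
  under [RHS]eq_bigr => i _ do rewrite mulrBr mulrCA.
  by rewrite sumrB -mulr_sumr uv mulr0 subr0.
have Bv i : \sum_j (N i j - e * v i 0) * v j 0 = (l ^+ k - 1) * v i 0.
  have := congr1 (fun M : 'cV[F]_m.+1 => M i 0) Nv; rewrite !mxE => Nvi.
  under eq_bigr do rewrite mulrBl.
  rewrite sumrB Nvi -mulr_sumr -/S mulrAC mulVf ?gt_eqF//.
  by rewrite mul1r mulrBl mul1r.
pose U := \sum_j `|u 0 j| * v j 0.
have U0 : 0 < U.
  rewrite lt_def sumr_ge0 ?andbT; last first.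
    by move=> j _; rewrite mulr_ge0// ltW.
  apply: contra_neq u0 => U0; apply/rowP => j; rewrite mxE; apply/eqP.
  have := psumr_eq0P _ U0; move=> /(_ _ j isT) Uj.
  have /eqP : `|u 0 j| * v j 0 = 0.
    by apply: Uj => i _; rewrite mulr_ge0// ltW.
  by rewrite mulf_eq0 normr_eq0 (gt_eqF (v0 j)) orbF.
have : `|z| ^+ k * U <= (l ^+ k - 1) * U.
  rewrite /U !mulr_sumr.
  apply: (@le_trans _ _ (\sum_j \sum_i `|u 0 i| * (N i j - e * v i 0) * v j 0)).
    apply: ler_sum => j _; rewrite mulrA -normrX -normrM uB -mulr_suml.
    rewrite ler_pM2r//; apply: (le_trans (ler_norm_sum _ _ _)).
    by apply: ler_sum => i _; rewrite normrM [X in _ * X]ger0_norm.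
  rewrite exchange_big /=; apply: ler_sum => i _.
  under eq_bigr do rewrite -mulrA.
  by rewrite -mulr_sumr Bv mulrCA.
rewrite ler_pM2r// => zk.
rewrite -(ltr_pXn2r k0) ?nnegrE//.
by apply: (le_lt_trans zk); rewrite gtrBl.
Qed.

Lemma perron_frobenius_eigenvalueI (R : realType) (m : nat)
    (A : 'M[nat]_m.+1) (v : 'cV[R]_m.+1) (l : R) :
  perron_frobenius A -> 1 < l -> (forall i, 0 < v i 0) ->
  nat_mx R A *m v = l *: v -> perron_frobenius_eigenvalue A l.
Proof.
move=> Apf l1 v0 Av; split => //.
  apply: right_eigenvalue Av; apply/eqP => /(congr1 (fun M : 'cV[R]_m.+1 => M 0 0)).
  by rewrite mxE => v00; have := v0 0; rewrite v00 ltxx.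
move=> z zA zl.
apply: (@positive_eigenvector_dominates _ _ A (map_mx (real_complex R) v)) => //.
- by rewrite ler0c ltW// (lt_trans ltr01).
- by move=> i; rewrite mxE ltcR.
have -> : nat_mx R[i] A = map_mx (real_complex R) (nat_mx R A).
  by apply/matrixP => i j; rewrite !mxE rmorph_nat.
by rewrite -map_mxM Av map_mxZ.
Qed.

(** * The factors of the matrix *)

Lemma mul_pos_entry (m : nat) (A B : 'M[nat]_m) (i k j : 'I_m) :
  (0 < A i k)%N -> (0 < B k j)%N -> (0 < (A *m B) i j)%N.
Proof.
move=> Aik Bkj; rewrite mxE (bigD1 k)//=.
by rewrite (leq_trans _ (leq_addr _ _))// muln_gt0 Aik.
Qed.

Lemma prod_pos_diag (m n : nat) (F : nat -> 'M[nat]_m.+1) :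
  (forall k (i : 'I_m.+1), (0 < F k i i)%N) ->
  forall i, (0 < (\prod_(0 <= k < n) F k)%R i i)%N.
Proof.
move=> F0; elim: n => [|n IHn] i.
  by rewrite big_geq// mxE eqxx.
by rewrite big_nat_recr//=; apply: (mul_pos_entry (IHn i)).
Qed.

Lemma prod_pos_entry (m n : nat) (F : nat -> 'M[nat]_m.+1) (k : nat) (i j : 'I_m.+1) :
  (forall k (i : 'I_m.+1), (0 < F k i i)%N) -> (k < n)%N -> (0 < F k i j)%N ->
  (0 < (\prod_(0 <= k < n) F k)%R i j)%N.
Proof.
move=> F0; elim: n => // n IHn; rewrite ltnS leq_eqVlt => kn Fij.
rewrite big_nat_recr//=; case/orP: kn => [/eqP <-|kn].
  exact: mul_pos_entry (prod_pos_diag _ F0 i) Fij.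
exact: mul_pos_entry (IHn kn Fij) (F0 _ _).
Qed.

Lemma mx3E (s : seq (seq nat)) (i j : 'I_3) :
  mx3 s i j = nth 0%N (nth [::] s i) j.
Proof. by rewrite mxE. Qed.

Lemma M1X (a : nat) :
  M1 ^+ a = mx3 [:: [:: 1; a; 0]; [:: 0; 1; 0]; [:: 0; 0; 1]]%N.
Proof.
elim: a => [|a IHa].
  by apply/matrixP => -[[|[|[|//]]] ?] -[[|[|[|//]]] ?]; rewrite expr0 !(mxE, mx3E).
rewrite exprS ?/M1 ?/M2 ?/M3 IHa; apply/matrixP => -[[|[|[|//]]] ?] -[[|[|[|//]]] ?];
  rewrite !(mxE, mx3E) !big_ord_recr big_ord0 /= !(mxE, mx3E) /=; lia.
Qed.

Lemma M2X (c : nat) :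
  M2 ^+ c = mx3 [:: [:: 1; 0; 0]; [:: c; 1; c]; [:: 0; 0; 1]]%N.
Proof.
elim: c => [|c IHc].
  by apply/matrixP => -[[|[|[|//]]] ?] -[[|[|[|//]]] ?]; rewrite expr0 !(mxE, mx3E).
rewrite exprS ?/M1 ?/M2 ?/M3 IHc; apply/matrixP => -[[|[|[|//]]] ?] -[[|[|[|//]]] ?];
  rewrite !(mxE, mx3E) !big_ord_recr big_ord0 /= !(mxE, mx3E) /=; lia.
Qed.

Lemma M3X (b : nat) :
  M3 ^+ b = mx3 [:: [:: 1; 0; 0]; [:: 0; 1; 0]; [:: 0; b; 1]]%N.
Proof.
elim: b => [|b IHb].
  by apply/matrixP => -[[|[|[|//]]] ?] -[[|[|[|//]]] ?]; rewrite expr0 !(mxE, mx3E).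
rewrite exprS ?/M1 ?/M2 ?/M3 IHb; apply/matrixP => -[[|[|[|//]]] ?] -[[|[|[|//]]] ?];
  rewrite !(mxE, mx3E) !big_ord_recr big_ord0 /= !(mxE, mx3E) /=; lia.
Qed.

Lemma MfactorE (n : nat) (P : params n) (i : int) :
  let a := cyc (par_p P) i in let b := cyc (par_p' P) i in
  let c := cyc (par_q P) i in
  Mfactor P i = mx3 [:: [:: (a * c).+1; a; a * c]; [:: c; 1; c];
                        [:: b * c; b; (b * c).+1]]%N.
Proof.
rewrite /Mfactor M1X M2X M3X.
set a := cyc _ _; set b := cyc _ _; set c := cyc _ _.
move=> /=; apply/matrixP => -[[|[|[|//]]] ?] -[[|[|[|//]]] ?];
  rewrite !(mxE, mx3E) !big_ord_recr big_ord0 /= !(mxE, mx3E) /=;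
  rewrite !big_ord_recr !big_ord0 /= !(mxE, mx3E) /=; lia.
Qed.

Definition col3 (R : pzSemiRingType) (x y z : R) : 'cV[R]_3 :=
  \col_(i < 3) nth 0 [:: x; y; z] i.

(** Shearing in two stages: M2 first feeds the outer entries into the middle one,
    then M1 and M3 feed the new middle entry h back into the outer ones. *)
Lemma Mfactor_col3 (R : comNzRingType) (n : nat) (P : params n) (i : int)
    (x y z : R) :
  let h := y + (cyc (par_q P) i)%:R * (x + z) in
  nat_mx R (Mfactor P i) *m col3 x y z =
    col3 (x + (cyc (par_p P) i)%:R * h) h (z + (cyc (par_p' P) i)%:R * h).
Proof.
move=> h; rewrite MfactorE.
apply/matrixP => -[[|[|[|//]]] ?] -[[|//] ?];
  rewrite !mxE !big_ord_recr big_ord0 /= !(mxE, mx3E) /= /h -?natr1 ?natrM; ring.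
Qed.

(** * Periodic parameters and continued fraction coefficients *)

(** Both the matrix product and the recursion for (w, h) run through the
    parameters by decreasing index, starting from n. *)
Definition cyc_down (n : nat) (x : 'I_n -> nat) (k : nat) : nat :=
  cyc x (n%:Z - k%:Z).

Lemma cyc_downDr (n : nat) (x : 'I_n -> nat) (k : nat) :
  cyc_down x (k + n) = cyc_down x k.
Proof.
rewrite /cyc_down /cyc PoszD -(modzDr _ n%:Z); congr (oapp _ _ (insub `|(_ %% _)%Z|%N)).
lia.
Qed.

Lemma cyc_down_mod (n : nat) (x : 'I_n -> nat) (k : nat) :
  cyc_down x (k %% n) = cyc_down x k.
Proof.
rewrite [in RHS](divn_eq k n); elim: (k %/ n)%N => [|q IHq]; first by rewrite mul0n.
by rewrite mulSn -addnA addnC cyc_downDr.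
Qed.

Lemma cyc_oppE (n : nat) (x : 'I_n -> nat) (k : nat) :
  cyc x (- k%:Z) = cyc_down x k.
Proof. by rewrite /cyc_down /cyc addrC modzDr. Qed.

Lemma cyc_down_gt0 (n : nat) (x : 'I_n -> nat) (k : nat) :
  (0 < n)%N -> (forall i, (0 < x i)%N) -> (0 < cyc_down x k)%N.
Proof.
move=> n0 x0; rewrite /cyc_down /cyc.
set r := `|_|%N; have rn : (r < n)%N.
  have := ltz_pmod (n%:Z - k%:Z) (d := n%:Z); rewrite ltz_nat n0 => /(_ isT).
  by have := modz_ge0 (n%:Z - k%:Z) (d := n%:Z); rewrite /r; lia.
by rewrite insubT.
Qed.

Lemma cyc_down_addn (n : nat) (x y : 'I_n -> nat) (k : nat) :
  cyc_down (fun i => x i + y i)%N k = (cyc_down x k + cyc_down y k)%N.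
Proof. by rewrite /cyc_down /cyc; case: insubP. Qed.

Lemma cyc_down_surj (n : nat) (x : 'I_n -> nat) (j : 'I_n) :
  exists2 k, (k < n)%N & cyc_down x k = x j.
Proof.
have n0 : (0 < n)%N := leq_ltn_trans (leq0n j) (ltn_ord j).
exists ((n - j) %% n)%N; first by rewrite ltn_mod.
rewrite cyc_down_mod /cyc_down /cyc.
have -> : `|((n%:Z - (n - j)%N%:Z) %% n%:Z)%Z|%N = j.
  rewrite -subzn 1?ltnW// opprB addrC subrK modz_nat modn_small//.
by rewrite valK.
Qed.

Lemma size_flatten_pairs (f g : nat -> nat) (m n : nat) :
  size (flatten [seq [:: f k; g k] | k <- iota m n]) = n.*2.
Proof. by elim: n m => //= n IHn m; rewrite IHn. Qed.

Lemma nth_flatten_pairs (f g : nat -> nat) (m n i : nat) : (i < n.*2)%N ->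
  nth 0%N (flatten [seq [:: f k; g k] | k <- iota m n]) i =
    (if odd i then g else f) (m + i./2)%N.
Proof.
elim: n m i => [|n IHn] m [|[|i]] //=; rewrite ?addn0// => ilt.
by rewrite IHn// negbK addSnnS.
Qed.

Lemma cf_coeffS (n : nat) (P : params n) (k : nat) : (0 < n)%N ->
  cf_coeff P k.+1 =
    if odd k then cyc_down (par_q P) k./2
    else (cyc_down (par_p P) k./2 + cyc_down (par_p' P) k./2)%N.
Proof.
move=> n0; rewrite /cf_coeff /preperiodic.
have -> : size (cf_period P) = n.*2.
  rewrite /cf_period; exact: size_flatten_pairs.
rewrite (nth_flatten_pairs (fun k => cyc (par_p P) (n%:Z - k%:Z) + _ )%N _ 0); last first.
  by rewrite ltn_mod double_gt0.
(* The position in the period is k mod 2n: parity selects the kind of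
   coefficient and the half of it, k./2 mod n, selects the index. *)
have kn : (k %% n.*2 = odd k + (k./2 %% n).*2)%N.
  rewrite -{1}(odd_double_half k) {1}(divn_eq k./2 n) doubleD doubleMr.
  rewrite addnCA modnMDl modn_small//.
  by have := ltn_pmod k./2 n0; lia.
rewrite kn half_bit_double oddD odd_double addbF oddb add0n.
case: odd; first exact: cyc_down_mod.
by rewrite -(cyc_down_mod (par_p P)) -(cyc_down_mod (par_p' P)).
Qed.

(** The complete quotients of the periodic part of the continued fraction of
    h_0; the leading coefficient 0 is skipped. *)
Definition cf_tail (R : realType) (n : nat) (P : params n) (k : nat) : R :=
  contfrac R (fun i => cf_coeff P (i + k).+1).

Lemma cf_coeff_gt0 (n : nat) (P : params n) (k : nat) :
  (0 < n)%N -> admissible P -> (0 < cf_coeff P k.+1)%N.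
Proof.
move=> n0 [pp'0 q0 _ _]; rewrite cf_coeffS//.
case: odd; first exact: cyc_down_gt0.
by rewrite -cyc_down_addn cyc_down_gt0.
Qed.

Lemma cf_tailE (R : realType) (n : nat) (P : params n) (k : nat) :
  (0 < n)%N -> admissible P ->
  cf_tail R P k = (cf_coeff P k.+1)%:R + (cf_tail R P k.+1)^-1.
Proof.
move=> n0 hP; rewrite /cf_tail contfracE => [|i]; last exact: cf_coeff_gt0.
by congr (_ + (contfrac R _)^-1); apply: funext => i; rewrite addSnnS.
Qed.

Lemma cf_tail_gt1 (R : realType) (n : nat) (P : params n) (k : nat) :
  (0 < n)%N -> admissible P -> 1 < cf_tail R P k.
Proof. by move=> n0 hP; apply: contfrac_gt1 => i; exact: cf_coeff_gt0. Qed.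

Lemma cf_tail_period (R : realType) (n : nat) (P : params n) : (0 < n)%N ->
  cf_tail R P n.*2 = cf_tail R P 0.
Proof.
move=> n0; congr contfrac; apply: funext => i.
rewrite addn0 !cf_coeffS// oddD odd_double addbF halfD odd_double andbF add0n.
by rewrite doubleK !cyc_downDr.
Qed.

(** * The Euclidean algorithm and its period *)

Lemma w_S (R : realType) (n : nat) (P : params n) (k : nat) :
  w_ R P k.+1 = w_ R P k
    - (cyc_down (par_p P) k + cyc_down (par_p' P) k)%:R * h_ R P k.
Proof.
by rewrite /w_ /h_ /= (_ : n%:Z - k.+1%:Z + 1 = n%:Z - k%:Z)//; lia.
Qed.

Lemma h_S (R : realType) (n : nat) (P : params n) (k : nat) :
  h_ R P k.+1 = h_ R P k - (cyc_down (par_q P) k)%:R * w_ R P k.+1.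
Proof.
by rewrite /w_ /h_ /= (_ : n%:Z - k.+1%:Z + 1 = n%:Z - k%:Z)//; lia.
Qed.

Lemma h_0 (R : realType) (n : nat) (P : params n) :
  (0 < n)%N -> admissible P -> h_ R P 0 = (cf_tail R P 0)^-1.
Proof.
move=> n0 hP; rewrite /h_ /= contfracE => [|i]; last exact: cf_coeff_gt0.
rewrite /= add0r /cf_tail.
by congr (contfrac R _)^-1; apply: funext => i; rewrite addn0.
Qed.

(** Each subtraction removes the integer coefficient from the current complete
    quotient and leaves the reciprocal of the next one; one step of (w, h) makes
    two such subtractions. *)
Lemma wh_ratio (R : realType) (n : nat) (P : params n) (k : nat) :
  (0 < n)%N -> admissible P ->
  0 < w_ R P k /\ h_ R P k = w_ R P k / cf_tail R P k.*2.
Proof.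
move=> n0 hP; elim: k => [|k [w0 hE]].
  by split; [rewrite /w_ ltr01|rewrite h_0// /w_ /= mul1r].
have t0 j : 0 < cf_tail R P j by rewrite (lt_trans ltr01)// cf_tail_gt1.
have wE : w_ R P k.+1 = h_ R P k / cf_tail R P k.*2.+1.
  have wh : w_ R P k = h_ R P k * cf_tail R P k.*2.
    by rewrite hE divfK// gt_eqF.
  rewrite w_S wh cf_tailE// cf_coeffS// odd_double doubleK.
  by rewrite mulrDr [_ * h_ R P k]mulrC addrAC subrr add0r.
split; first by rewrite wE hE !divr_gt0.
have hw : h_ R P k = w_ R P k.+1 * cf_tail R P k.*2.+1.
  by rewrite wE divfK// gt_eqF.
rewrite h_S hw cf_tailE// cf_coeffS//= odd_double /= uphalf_double.
by rewrite mulrDr [_ * w_ R P k.+1]mulrC addrAC subrr add0r doubleS.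
Qed.

Lemma w_gt0 (R : realType) (n : nat) (P : params n) (k : nat) :
  (0 < n)%N -> admissible P -> 0 < w_ R P k.
Proof. by move=> n0 hP; case: (wh_ratio R k n0 hP). Qed.

Lemma h_gt0 (R : realType) (n : nat) (P : params n) (k : nat) :
  (0 < n)%N -> admissible P -> 0 < h_ R P k.
Proof.
move=> n0 hP; case: (wh_ratio R k n0 hP) => w0 ->.
by rewrite divr_gt0// (lt_trans ltr01)// cf_tail_gt1.
Qed.

Lemma w_lt1 (R : realType) (n : nat) (P : params n) (k : nat) :
  (0 < n)%N -> admissible P -> (0 < k)%N -> w_ R P k < 1.
Proof.
move=> n0 hP; have [pp'0 _ _ _] := hP.
have step j : w_ R P j.+1 < w_ R P j.
  rewrite w_S gtrBl mulr_gt0 ?h_gt0// ltr0n -cyc_down_addn.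
  exact: cyc_down_gt0.
case: k => // k _.
by elim: k => [|k IHk]; [exact: step|exact: lt_trans (step _) IHk].
Qed.

(** The ratio h_n / w_n returns to h_0 by periodicity of the complete quotients;
    the recursion being linear with periodic coefficients, proportionality by
    w_n then persists. *)
Lemma wh_period (R : realType) (n : nat) (P : params n) (k : nat) :
  (0 < n)%N -> admissible P ->
  w_ R P (k + n) = w_ R P n * w_ R P k /\ h_ R P (k + n) = w_ R P n * h_ R P k.
Proof.
move=> n0 hP; elim: k => [|k [IHw IHh]].
  have [_ ->] := wh_ratio R n n0 hP.
  by rewrite cf_tail_period// h_0// mulr1.
have wE : w_ R P (k.+1 + n) = w_ R P n * w_ R P k.+1.
  by rewrite addSn !w_S IHw IHh !cyc_downDr mulrBr mulrCA.
split=> //; move: wE; rewrite addSn !h_S => ->.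
by rewrite IHh cyc_downDr [RHS]mulrBr [in RHS]mulrCA.
Qed.

(** * The split ratio *)

Lemma split_termE (R : realType) (n : nat) (P : params n) (k : nat) :
  split_term R P k = (cyc_down (par_p P) k)%:R * h_ R P k.
Proof. by rewrite /split_term cyc_oppE. Qed.

Lemma split_term_ge0 (R : realType) (n : nat) (P : params n) (k : nat) :
  (0 < n)%N -> admissible P -> 0 <= split_term R P k.
Proof. by move=> n0 hP; rewrite split_termE mulr_ge0// ltW// h_gt0. Qed.

(** The length removed from w at stage i, namely (a_i + b_i) h_i, is split
    between the series with coefficients a_i and the one with coefficients b_i;
    the total removed up to stage k is 1 - w_k. *)
Lemma split_series_complement (R : realType) (n : nat) (P : params n)
    (k : nat) :
  1 - series (split_term R P) k =
    w_ R P k + \sum_(0 <= i < k) (cyc_down (par_p' P) i)%:R * h_ R P i.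
Proof.
elim: k => [|k IHk]; first by rewrite /series /= !big_geq// subr0 addr0.
rewrite /series /= !big_nat_recr//= split_termE opprD addrA.
rewrite -[\sum_(_ <= _ < _) split_term _ _ _]/(series (split_term R P) k) IHk.
by rewrite w_S natrD; ring.
Qed.

Lemma split_series_nondecreasing (R : realType) (n : nat) (P : params n) :
  (0 < n)%N -> admissible P -> nondecreasing_seq (series (split_term R P)).
Proof.
move=> n0 hP; apply/nondecreasing_seqP => k.
by rewrite /series /= big_nat_recr//= lerDl split_term_ge0.
Qed.

Lemma split_series_cvg (R : realType) (n : nat) (P : params n) :
  (0 < n)%N -> admissible P -> cvgn (series (split_term R P)).
Proof.
move=> n0 hP; apply: nondecreasing_is_cvgn.
  exact: split_series_nondecreasing.
exists 1 => _ [k _ <-]; rewrite -subr_ge0 split_series_complement.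
rewrite addr_ge0 ?(ltW (w_gt0 R k n0 hP))// sumr_ge0// => i _.
by rewrite mulr_ge0// ltW// h_gt0.
Qed.

Lemma split_ratio_gt0 (R : realType) (n : nat) (P : params n) :
  (0 < n)%N -> admissible P -> 0 < split_ratio R P.
Proof.
move=> n0 hP; have [_ _ [j pj] _] := hP.
have [k _ pk] := cyc_down_surj (par_p P) j.
have := nondecreasing_cvgn_le (@split_series_nondecreasing R n P n0 hP)
  (@split_series_cvg R n P n0 hP) k.+1.
apply: lt_le_trans; rewrite /series /= big_nat_recr//= ltr_wpDl//.
  by apply: sumr_ge0 => i _; exact: split_term_ge0.
by rewrite split_termE mulr_gt0 ?h_gt0// pk ltr0n.
Qed.

(** Beyond a stage k with b_k > 0, the complementary sums keep the partial sums
    of the split series below 1 - b_k h_k. *)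
Lemma split_ratio_lt1 (R : realType) (n : nat) (P : params n) :
  (0 < n)%N -> admissible P -> split_ratio R P < 1.
Proof.
move=> n0 hP; have [_ _ _ [j pj]] := hP.
have [k _ pk] := cyc_down_surj (par_p' P) j.
have t0 : 0 < (cyc_down (par_p' P) k)%:R * h_ R P k.
  by rewrite mulr_gt0 ?h_gt0// pk ltr0n.
apply: (@le_lt_trans _ _ (1 - (cyc_down (par_p' P) k)%:R * h_ R P k)); last first.
  by rewrite gtrBl.
apply: limr_le; first exact: split_series_cvg.
exists k.+1 => // N /= kN; rewrite lerBrDl -lerBrDr split_series_complement.
rewrite ler_wpDl ?(ltW (w_gt0 R N n0 hP))//.
rewrite big_mkord (bigD1 (Ordinal kN))//= lerDl sumr_ge0// => i _.
by rewrite mulr_ge0// ltW// h_gt0.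
Qed.

Lemma split_series_addn (R : realType) (n : nat) (P : params n) (k : nat) :
  (0 < n)%N -> admissible P ->
  series (split_term R P) (k + n)%N =
    series (split_term R P) n + w_ R P n * series (split_term R P) k.
Proof.
move=> n0 hP; elim: k => [|k IHk].
  by rewrite add0n [X in _ * X]/series /= big_geq// mulr0 addr0.
rewrite addSn !seriesSr IHk !split_termE.
have [_ ->] := wh_period R k n0 hP.
by rewrite cyc_downDr mulrDr addrA mulrCA.
Qed.

(** After one period the split series reproduces itself, scaled by w_n. *)
Lemma split_ratio_period (R : realType) (n : nat) (P : params n) :
  (0 < n)%N -> admissible P ->
  split_ratio R P - series (split_term R P) n = w_ R P n * split_ratio R P.
Proof.
move=> n0 hP; apply/eqP; rewrite subr_eq addrC; apply/eqP.
apply/cvg_lim => //; rewrite -(cvg_shiftn n) /=.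
under eq_cvg do rewrite split_series_addn//.
apply: cvgD; first exact: cvg_cst.
by apply: cvgM; [exact: cvg_cst|exact: split_series_cvg].
Qed.

(** * The eigenvector and its eigenvalue *)

Definition tail_vector (R : realType) (n : nat) (P : params n) (k : nat) :
    'cV[R]_3 :=
  let s := split_ratio R P - series (split_term R P) k in
  col3 s (h_ R P k) (w_ R P k - s).

Lemma pf_vectorE (R : realType) (n : nat) (P : params n) :
  pf_vector R P = tail_vector R P 0.
Proof. by rewrite /tail_vector /series /= big_geq// subr0. Qed.

Lemma Mfactor_tail_vector (R : realType) (n : nat) (P : params n) (k : nat) :
  nat_mx R (Mfactor P (n%:Z - k%:Z)) *m tail_vector R P k.+1 = tail_vector R P k.
Proof.
rewrite Mfactor_col3 -!/(cyc_down _ k) subrKC h_S subrK.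
rewrite w_S seriesSr split_termE natrD.
by congr col3; ring.
Qed.

Lemma Mprod_tail_vector (R : realType) (n : nat) (P : params n) (k : nat) :
  nat_mx R (\prod_(0 <= i < k) Mfactor P (n%:Z - i%:Z)) *m tail_vector R P k =
    tail_vector R P 0.
Proof.
elim: k => [|k IHk].
  by rewrite big_geq// /nat_mx (map_mx1 (GRing.natmul (1 : R))) mul1mx.
rewrite big_nat_recr//= /nat_mx (map_mxM (GRing.natmul (1 : R))) -mulmxA.
by rewrite [X in _ *m X]Mfactor_tail_vector.
Qed.

Lemma tail_vector_period (R : realType) (n : nat) (P : params n) :
  (0 < n)%N -> admissible P ->
  tail_vector R P n = w_ R P n *: tail_vector R P 0.
Proof.
move=> n0 hP; rewrite /tail_vector split_ratio_period//.
have [_] := wh_period R 0 n0 hP; rewrite add0n => ->.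
rewrite [in RHS]/series /= big_geq// subr0 (_ : w_ R P 0 = 1)//.
apply/matrixP => -[[|[|[|//]]] ?] -[[|//] ?]; rewrite !mxE //=; ring.
Qed.

(** The middle row and the middle column of M_p are positive, and every entry
    (i, l) of the square contains the product of the entries (i, 1) and (1, l). *)
Lemma Mmat_perron_frobenius (n : nat) (P : params n) :
  (0 < n)%N -> admissible P -> perron_frobenius (Mmat P).
Proof.
move=> n0 [pp'0 q0 [j pj] [j' pj']].
have F0 k (i : 'I_3) : (0 < Mfactor P (n%:Z - k%:Z) i i)%N.
  by rewrite MfactorE mx3E; case: i => -[|[|[|//]]].
have Fpos k (i l : 'I_3) : (k < n)%N ->
    (0 < Mfactor P (n%:Z - k%:Z) i l)%N -> (0 < Mmat P i l)%N.
  exact: (prod_pos_entry F0).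
have q0' := cyc_down_gt0 0 n0 q0.
have [k kn pk] := cyc_down_surj (par_p P) j.
have [k' kn' pk'] := cyc_down_surj (par_p' P) j'.
have M1_ (i : 'I_3) : (0 < Mmat P 1%R i)%N.
  by apply: (Fpos 0%N _ _ n0); rewrite MfactorE mx3E; case: i => -[|[|[|//]]].
have M_1 (i : 'I_3) : (0 < Mmat P i 1%R)%N.
  case: i => -[|[|[|//]]] i3.
  - by apply: (Fpos k) => //; rewrite MfactorE mx3E /= -/(cyc_down _ k) pk.
  - by rewrite (_ : Ordinal i3 = 1%R); [exact: M1_|exact: val_inj].
  - by apply: (Fpos k') => //; rewrite MfactorE mx3E /= -/(cyc_down _ k') pk'.
exists 2%N => // i l; rewrite expr2.
exact: mul_pos_entry (M_1 i) (M1_ l).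
Qed.

Theorem theorem2p13 (R : realType) (n : nat) (hn : (1 <= n)%N)
    (P : params n) (hP : admissible P) :
  cvgn (cf_convergent R (cf_coeff P)) /\
  cvgn (series (split_term R P)) /\
  perron_frobenius_eigenvalue (Mmat P) (1 / w_ R P n) /\
  (forall i, 0 < pf_vector R P i 0) /\
  nat_mx R (Mmat P) *m pf_vector R P = (1 / w_ R P n) *: pf_vector R P.
Proof.
have w0 := w_gt0 R n hn hP.
have v0 i : 0 < pf_vector R P i 0.
  rewrite mxE; case: i => -[|[|[|//]]] ? /=.
  - exact: split_ratio_gt0.
  - exact: h_gt0.
  - by rewrite subr_gt0 split_ratio_lt1.
have Mv : nat_mx R (Mmat P) *m pf_vector R P = (1 / w_ R P n) *: pf_vector R P.
  rewrite pf_vectorE -[in RHS](Mprod_tail_vector R P n) tail_vector_period//.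
  by rewrite -scalemxAr scalerA mul1r mulVf ?scale1r// gt_eqF.
split; first by apply: cf_convergent_cvg => i; exact: cf_coeff_gt0.
split; first exact: split_series_cvg.
split; last by [].
apply: perron_frobenius_eigenvalueI v0 Mv.
  exact: Mmat_perron_frobenius.
by rewrite div1r invf_gt1// w_lt1.
Qed.
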